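(* The number $can_{m,n}(q)$ of canonical elements in $Dist(T_r)$ for $GL(m|n)$ is given as $$can_{m,1}(q)=q\binom{q-\frac{q}{p}+m-1}{m}+\frac{q}{p}\binom{p+m-2}{m-1},$$ $$can_{1,n}(q)=q\binom{q-\frac{q}{p}+n-1}{n}+\frac{q}{p}\binom{p+n-2}{n-1},$$ and $$\begin{aligned}can_{m,n}(q)=&\sum_{l=1}^{\min\{p-1,n\}}\binom{p}{l}\binom{q-\frac{q}{p}l+m-1}{m}\sum_{\substack{n_1,\ldots,n_l>0\\ n_1+\cdots+n_l=n}}\prod_{j=1}^l\binom{\frac{q}{p}+n_j-1}{n_j}\\&+\frac{q}{p}\left[-1+\binom{p+m-2}{m-1}+\binom{p+n-2}{n-1}\right]\\&+\frac{q}{p}\sum_{e=1}^{m-1}\sum_{f=1}^{n-1}\sum_{l=1}^{\min\{f,p-2\}}\binom{p-1}{l}\binom{f-1}{f-l}\binom{e+p-l-2}{e}\end{aligned}$$ for $m,n>1$.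
   Context: $p$ is a prime, $r\ge1$, $q=p^r$, $m,n\ge1$. Canonical elements are certain tuples $(a_1,\ldots,a_m|b_1,\ldots,b_n)$ of integers with $0\le a_i,b_j<q$, defined as follows. The defect $d$ of a tuple is the maximal $d$ for which there are distinct indices $i_1,\ldots,i_d\in\{1,\ldots,m\}$ and distinct $j_1,\ldots,j_d\in\{1,\ldots,n\}$ with $a_{i_t}+b_{j_t}\equiv0\pmod p$ for all $t$. A tuple of defect $0$ is canonical if $a_1\le\cdots\le a_m$ and $b_1\le\cdots\le b_n$. A tuple of defect $d>0$ is canonical if there are indices $e,f$ with $d=\min\{e,f\}$, $a_1=\cdots=a_e=0$, $0<a_{e+1}\le\cdots\le a_m<p$, $b_1=\cdots=b_{f-1}=0$, $b_f$ divisible by $p$, $0<b_{f+1}\le\cdots\le b_n<p$, and $a_i+b_j\not\equiv0\pmod p$ for $i>e$, $j>f$. Empty sums are $0$. *)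

(* Defs.v *)
From mathcomp Require Import all_boot.

Set Implicit Arguments.
Unset Strict Implicit.
Unset Printing Implicit Defensive.

(* A tuple (a_1,...,a_m | b_1,...,b_n) with 0 <= a_i, b_j < q is represented
   by a : m.-tuple 'I_q and b : n.-tuple 'I_q.  Positions are 0-based, so the
   entry a_i is tnth a at position i - 1. *)

(* A matching of size d consists of two injective families of indices, so
   d <= min(m, n): bounding d in the maximum below loses nothing. *)
Definition has_matching (p q m n : nat) (a : m.-tuple 'I_q) (b : n.-tuple 'I_q)
    (d : nat) : bool :=
  [exists i : {ffun 'I_d -> 'I_m}, exists j : {ffun 'I_d -> 'I_n},
    [&& injectiveb i, injectiveb j &
        [forall t : 'I_d, p %| tnth a (i t) + tnth b (j t)]]].

Definition defect (p q m n : nat) (a : m.-tuple 'I_q) (b : n.-tuple 'I_q) : nat :=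
  \max_(d < (minn m n).+1 | has_matching p a b d) d.

Definition nondecreasing (q : nat) (s : seq 'I_q) : bool :=
  sorted (fun x y : 'I_q => x <= y) s.

(* The parameters e and f keep their 1-based meaning: "i <= e" in 1-based
   numbering is "i < e" here, and b_f is the entry at position j = f - 1. *)
Definition canonical_shape (p q m n : nat) (a : m.-tuple 'I_q)
    (b : n.-tuple 'I_q) (e f : nat) : bool :=
  [&& [forall i : 'I_m, (i < e) ==> (tnth a i == 0 :> nat)],
      [forall i : 'I_m, (e <= i) ==> (0 < tnth a i < p)],
      nondecreasing (drop e a),
      [forall j : 'I_n, (j.+1 < f) ==> (tnth b j == 0 :> nat)],
      [forall j : 'I_n, (j.+1 == f) ==> (p %| tnth b j)],
      [forall j : 'I_n, (f <= j) ==> (0 < tnth b j < p)],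
      nondecreasing (drop f b) &
      [forall i : 'I_m, forall j : 'I_n,
        (e <= i) && (f <= j) ==> ~~ (p %| tnth a i + tnth b j)]].

(* In the positive-defect case e <= m and f <= n by typing, while
   d = min(e, f) > 0 forces e, f >= 1. *)
Definition canonical (p q m n : nat) (a : m.-tuple 'I_q) (b : n.-tuple 'I_q) :
    bool :=
  if defect p a b == 0 then nondecreasing a && nondecreasing b
  else [exists e : 'I_m.+1, exists f : 'I_n.+1,
         (defect p a b == minn e f) && canonical_shape p a b e f].

Definition can (p q m n : nat) : nat :=
  #|[set ab : m.-tuple 'I_q * n.-tuple 'I_q | canonical p ab.1 ab.2]|.

(* Sum over n_1, ..., n_l > 0 with n_1 + ... + n_l = n of
   \prod_j binomial(k + n_j - 1, n_j); each part is at most n, hence the type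
   'I_n.+1. *)
Definition composition_sum (k l n : nat) : nat :=
  \sum_(c : {ffun 'I_l -> 'I_n.+1} |
          [forall j, 0 < c j] && (\sum_(j < l) c j == n))
    \prod_(j < l) 'C(k + c j - 1, c j).

(* Main.v *)
Require Import Defs.
From mathcomp Require Import all_boot.
From mathcomp Require Import zify.
From mathcomp Require ssralg poly.

Set Implicit Arguments.
Unset Strict Implicit.
Unset Printing Implicit Defensive.

(** Write k = q/p and let M(a, n) = 'C(a + n - 1, n) be the number of multisets
of size n on a letters; a nondecreasing tuple is the same thing as a multiset.

Everything reduces to one counting problem: letters are grouped into c classes
of k letters each, and one counts pairs (u, v) of nondecreasing tuples of
lengths s and t such that no letter of u lies in the class opposite to that of
a letter of v.  If v meets exactly l classes, then u may use the k (c - l)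
letters of the other classes, whence M(k (c - l), s) choices.  The number of v
that meet exactly a given set of l classes is the sum over compositions of t
into l parts of the products of the M(k, t_j), i.e. [composition_sum k l t].
This is proved by binomial inversion rather than by splitting tuples along
classes: the tuples whose letters lie in the union of l given classes number
M(k l, t), and

    M(k l, t) = sum_j 'C(l, j) composition_sum k j t

because (1 - X)^(- k l) = (1 + F)^l, where 1 + F = (1 - X)^(- k) is the
generating function of the M(k, i) ([binomial_composition_sum]).  The resulting
count is [card_avoiding_pairs].

Canonical tuples of defect 0 are the pairs for the p residue classes of
{0, ..., q - 1}, all of size k.  In positive defect the indices e and f are
determined by the tuple ([shape_unique]), b_f is any of the k multiples of p,
the entries before it are 0, and the remaining entries form a pair on the
letters {1, ..., p - 1}, whose classes are singletons
([card_with_shape]).  Summing over e and f gives [canE]; the closed formulas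
follow from M(a, 0) + ... + M(a, n) = M(a + 1, n), which sums the terms in which
one of the two tails is empty. *)

(** * Multisets and composition sums *)

Definition multichoose a n := 'C(a + n - 1, n).

Lemma multichoosen0 a : multichoose a 0 = 1.
Proof. by rewrite /multichoose bin0. Qed.

Lemma multichoose0n n : multichoose 0 n = (n == 0).
Proof. by case: n => [|n] //; rewrite /multichoose add0n subn1 bin_small. Qed.

Lemma multichoosen1 a : multichoose a 1 = a.
Proof. by rewrite /multichoose addnK bin1. Qed.

Lemma multichooseSS a n :
  multichoose a.+1 n.+1 = multichoose a.+1 n + multichoose a n.+1.
Proof. by rewrite /multichoose !addnS !addSn !subn1 /= binS addnC. Qed.

Lemma multichoose_Vandermonde a b n :
  \sum_(i < n.+1) multichoose a i * multichoose b (n - i) = multichoose (a + b) n.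
Proof.
elim: a n => [|a IHa] n.
  rewrite big_ord_recl multichoosen0 mul1n subn0 big1 ?addn0 // => i _.
  by rewrite multichoose0n.
elim: n => [|n IHn]; first by rewrite big_ord1 !multichoosen0.
rewrite addSn multichooseSS -addSn -IHn -IHa addnC.
rewrite [in RHS]big_ord_recl [in LHS]big_ord_recl !multichoosen0 -addnA.
congr (_ + _); rewrite -big_split; apply: eq_bigr => i _.
by rewrite /= /bump !add1n multichooseSS subSS mulnDl addnC.
Qed.

Lemma multichoose_hockey_stick a n :
  \sum_(i < n.+1) multichoose a i = multichoose a.+1 n.
Proof.
elim: n => [|n IHn]; first by rewrite big_ord1 !multichoosen0.
by rewrite big_ord_recr IHn multichooseSS.
Qed.

Section GeneratingFunction.
Import ssralg poly GRing.Theory.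
Local Open Scope ring_scope.

(** Expanding the l-th power gives a sum over functions 'I_l -> 'I_n.+1.
Dropping the constant term of the series enforces positive parts, and the
truncation at degree n is harmless because no part exceeds n. *)
Lemma composition_sum_coef k l n :
  composition_sum k l n =
  ((\poly_(i < n.+1) (if i == 0%N then 0%N else multichoose k i)) ^+ l)`_n.
Proof.
rewrite -[l in _ ^+ l]card_ord -prodr_const.
under eq_bigr => i _ do rewrite poly_def.
rewrite bigA_distr_bigA coef_sum /composition_sum big_mkcond.
apply: eq_bigr => c _.
under eq_bigr => i _ do rewrite -mul_polyC.
rewrite big_split /= prodrXr -rmorph_prod /= coefCM coefXn.
have -> : (\sum_(i < l) (c i : nat))%R = (\sum_(i < l) c i)%N by [].
case: (boolP [forall j, _]) => /= [/forallP c_gt0 | /forallPn [j]].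
  rewrite eq_sym; case: eqP => _ /=; last by rewrite mulr0.
  rewrite mulr1; apply: eq_bigr => j _.
  by case: (c j : nat) (c_gt0 j).
by rewrite -eqn0Ngt => /eqP cj0; rewrite (bigD1 j) //= cj0 !mul0r.
Qed.

(** With G = 1 + F the binomial theorem gives G ^+ l as the left-hand side, and
G ^+ l agrees with the series of the M(k l, i) up to degree n by the
Vandermonde identity for multisets. *)
Lemma binomial_composition_sum k l n :
  (\sum_(j < l.+1) 'C(l, j) * composition_sum k j n)%N = multichoose (k * l) n.
Proof.
under eq_bigr => j _ do rewrite composition_sum_coef.
set F := poly _ _; pose G := \poly_(i < n.+1) multichoose k i.
have GE : G = 1 + F.
  apply/polyP => i; rewrite coefD coef1 !coef_poly.
  by case: i => [|i] //=; rewrite ?multichoosen0 // add0r.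
have <- : (G ^+ l)`_n = (\sum_(j < l.+1) 'C(l, j) * ((F ^+ j)`_n)%R)%N.
  rewrite GE exprDn coef_sum; apply: eq_bigr => j _.
  by rewrite expr1n mul1r coefMn -mulr_natl natn.
move: {1 3 4}n (ltnSn n) => N.
elim: l N => [|l IHl] N ltNn.
  by rewrite expr0 coef1 muln0 multichoose0n; case: eqP.
rewrite exprS coefM mulnS -multichoose_Vandermonde.
apply: eq_bigr => i _; rewrite IHl; last exact: leq_ltn_trans (leq_subr _ _) _.
by rewrite coef_poly (leq_trans (ltn_ord i)).
Qed.
End GeneratingFunction.

Lemma composition_sum_small k l n : n < l -> composition_sum k l n = 0.
Proof.
move=> lt_nl; rewrite /composition_sum big1 // => c /andP[/forallP c0 /eqP cn].
suff : l <= n by rewrite leqNgt lt_nl.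
by rewrite -cn -[l in l <= _]card_ord -sum1_card leq_sum.
Qed.

Lemma composition_sum0n k n : composition_sum k 0 n = (n == 0).
Proof.
have := binomial_composition_sum k 0 n.
by rewrite big_ord1 mul1n muln0 multichoose0n.
Qed.

Lemma composition_sumn1 k n :
  composition_sum k 1 n = if n == 0 then 0 else multichoose k n.
Proof.
have := binomial_composition_sum k 1 n.
rewrite !big_ord_recl big_ord0 !mul1n addn0 muln1 composition_sum0n => <-.
case: n => [|n]; last by rewrite add0n.
by rewrite composition_sum_small.
Qed.

Lemma sum_subsets_card (K : finType) (C : {set K}) (F : nat -> nat) :
  \sum_(L : {set K} | L \subset C) F #|L| = \sum_(l < #|C|.+1) 'C(#|C|, l) * F l.
Proof.
have ltC (L : {set K}) : L \subset C -> #|L| < #|C|.+1.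
  by move=> LC; rewrite ltnS subset_leq_card.
rewrite (partition_big (fun L : {set K} => inord #|L| : 'I_#|C|.+1) xpredT) //=.
apply: eq_bigr => l _.
rewrite -cards_draws -sum_nat_const.
apply: eq_big => [L | L /andP[LC /eqP <-]]; last by rewrite inordK ?ltC.
rewrite !inE; case LC: (_ \subset _) => //=.
by rewrite -val_eqE /= inordK // ltC.
Qed.

(** Subset sums determine a set function: subtracting the terms of the proper
subsets, which agree by induction, leaves the term of L itself. *)
Lemma binomial_inversion (K : finType) (C : {set K}) (h : {set K} -> nat)
    (w : nat -> nat) :
    (forall L : {set K}, L \subset C ->
      \sum_(L' : {set K} | L' \subset L) h L' =
        \sum_(j < #|L|.+1) 'C(#|L|, j) * w j) ->
  forall L : {set K}, L \subset C -> h L = w #|L|.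
Proof.
move=> hw L; have [n] := ubnP #|L|; elim: n L => // n IHn L ltLn LC.
have := hw L LC; rewrite -sum_subsets_card.
rewrite (bigD1 L) //= [RHS](bigD1 L) //=.
set s := (X in _ + X = _); set s' := (X in _ = _ + X).
suff -> : s = s' by move/addIn.
apply: eq_bigr => L' /andP[sL' neL']; apply: IHn; last exact: subset_trans LC.
have ltL' : #|L'| < #|L| by apply: proper_card; rewrite properEneq neL'.
by rewrite -ltnS (leq_trans _ ltLn).
Qed.

(** A product of M(1, n_j) is 1, so this counts the compositions of n into l
parts.  By uniqueness in the inversion it suffices that the binomials on the
right have subset sums M(l, n), which is the Vandermonde identity. *)
Lemma composition_sum1l l n :
  0 < n -> 0 < l -> composition_sum 1 l n = 'C(n - 1, l - 1).
Proof.
case: n => // n _ l_gt0; rewrite [in RHS]subn1 /=.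
(* 'C(n, j.-1) is 1 rather than 0 at j = 0, where there is no composition. *)
pose w j := if j == 0 then 0 else 'C(n, j.-1).
suff wE j : w j = composition_sum 1 j n.+1.
  by rewrite -wE /w eqn0Ngt l_gt0 subn1.
rewrite -[j]card_ord -cardsT.
apply: (@binomial_inversion _ setT (fun L => w #|L|)
         (fun i => composition_sum 1 i n.+1) _ setT) => // L _.
rewrite sum_subsets_card binomial_composition_sum mul1n.
case: {L}#|L| => [|a]; first by rewrite big_ord1 multichoose0n.
rewrite big_ord_recl muln0 add0n.
have -> : multichoose a.+1 n.+1 = 'C(n + a.+1, a).
  rewrite /multichoose addnS subn1 /= -[in RHS]bin_sub ?addnS ?leqW ?leq_addl //.
  by rewrite -addSn addnK addSnnS addnC.
rewrite -Vandermonde.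
apply: eq_bigr => i _; rewrite lift0 /w /= mulnC.
by rewrite -['C(a.+1, i.+1)]bin_sub ?subSS ?ltn_ord.
Qed.

(** * Nondecreasing tuples that avoid opposite classes *)

Definition sorted_tuples q (R : {set 'I_q}) n : {set n.-tuple 'I_q} :=
  [set t : n.-tuple 'I_q | nondecreasing t && all (mem R) t].

Lemma card_sorted_tuplesT k n :
  #|[set t : n.-tuple 'I_k | nondecreasing t]| = multichoose k n.
Proof.
case: k => [|k].
  rewrite multichoose0n; case: n => [|n].
    rewrite -[RHS](card_tuple 0 'I_0) cardsE; apply: eq_card => t.
    by rewrite (tuple0 t).
  by apply: eq_card0 => t; case: (thead t).
rewrite /multichoose addSn subn1 -[k + n]addnC -card_sorted_tuples.
by apply: eq_card => t; rewrite !inE /nondecreasing sorted_map.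
Qed.

(** The increasing enumeration of R is an order isomorphism from 'I_#|R| onto R. *)
Lemma card_sorted_tuples_in q (R : {set 'I_q}) n :
  #|sorted_tuples R n| = multichoose #|R| n.
Proof.
rewrite -card_sorted_tuplesT.
pose f (t : n.-tuple 'I_#|R|) := map_tuple (@enum_val _ (mem R)) t.
have f_inj : injective f.
  move=> t u /(congr1 val) /= /(inj_map enum_val_inj); exact: val_inj.
have mono : {mono @enum_val _ (mem R) : i j / (i : nat) <= j >-> (i : nat) <= j}.
  have enum_ltn : sorted (fun x y : 'I_q => x < y) (enum R).
    rewrite /enum_mem sorted_filter; first by [].
      by move=> ? ? ?; exact: ltn_trans.
    by rewrite -enumT -(@sorted_map _ _ val ltn) val_enum_ord iota_ltn_sorted.
  have incr (i j : 'I_#|R|) : i < j -> enum_val i < enum_val j.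
    move=> lt_ij; have x0 := enum_val i; rewrite !(enum_val_nth x0).
    apply: (sorted_ltn_nth (leT := fun x y : 'I_q => x < y)) => //.
    - by move=> ? ? ?; exact: ltn_trans.
    - by rewrite inE -cardE.
    - by rewrite inE -cardE.
  move=> i j /=; case: (leqP i j) => [|/incr]; last by rewrite ltnNge => /negbTE.
  rewrite [i <= j]leq_eqVlt => /orP[/eqP/val_inj -> | /incr/ltnW -> //].
  by rewrite leqnn.
rewrite -(card_imset _ f_inj); apply: eq_card => t.
apply/idP/imsetP => [|[u]]; rewrite !inE /nondecreasing.
  case/andP=> st /allP tR.
  have [s st'] : exists s : n.-tuple 'I_#|R|, f s = t.
    case: n @f f_inj t st tR => [|n] f _ t st tR.
      exists [tuple]; apply: val_inj; by rewrite [t]tuple0.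
    have x0R : thead t \in R by apply: tR; exact: mem_tnth.
    exists (map_tuple (enum_rank_in x0R) t); apply: val_inj => /=.
    by rewrite -map_comp map_id_in // => x /tR xR /=; rewrite enum_rankK_in.
  exists s => //; rewrite inE; move: st; rewrite -st' /= sorted_map.
  by congr is_true; apply: eq_sorted => i j /=; rewrite mono.
move=> su ->; rewrite /= sorted_map; apply/andP; split.
  by move: su; congr is_true; apply: eq_sorted => i j /=; rewrite mono.
by apply/allP => x /mapP[i _ ->]; exact: enum_valP.
Qed.

Section AvoidingPairs.

Variables (q : nat) (K : finType) (cl : 'I_q -> K) (nu : K -> K).
Variables (R : {set 'I_q}) (C : {set K}) (k : nat).

Definition avoiding_pairs s t : {set s.-tuple 'I_q * t.-tuple 'I_q} :=
  [set uv | [&& uv.1 \in sorted_tuples R s, uv.2 \in sorted_tuples R t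
              & allrel (fun x y => cl x != nu (cl y)) uv.1 uv.2]].

Hypothesis nu_inj : injective nu.
Hypothesis nu_stable : {in C, forall c, nu c \in C}.
Hypothesis cl_in : {in R, forall x, cl x \in C}.
Hypothesis card_class : {in C, forall c, #|[set x in R | cl x == c]| = k}.

(** The preimage of D splits into #|D| classes of size k. *)
Lemma card_class_union (D : {set K}) :
  D \subset C -> #|[set x in R | cl x \in D]| = k * #|D|.
Proof.
move=> /subsetP DC.
rewrite -sum1_card (partition_big cl (mem D)) /=; last first.
  by move=> x; rewrite inE => /andP[].
rewrite mulnC -sum_nat_const; apply: eq_bigr => c cD.
rewrite -(card_class (DC _ cD)) -sum1_card; apply: eq_bigl => x.
by rewrite !inE -andbA; case: eqP => [->|_]; rewrite ?cD ?andbF.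
Qed.

Definition class_set t (v : t.-tuple 'I_q) := [set cl y | y in v].

Lemma class_set_subset t (v : t.-tuple 'I_q) (D : {set K}) :
  (class_set v \subset D) = all (fun y => cl y \in D) v.
Proof.
apply/subsetP/allP => [vD y yv | vD _ /imsetP[y yv ->]]; last exact: vD.
by apply: vD; exact: imset_f.
Qed.

Lemma sorted_tuples_class t (v : t.-tuple 'I_q) (D : {set K}) :
  (v \in sorted_tuples [set x in R | cl x \in D] t) =
    (v \in sorted_tuples R t) && (class_set v \subset D).
Proof.
rewrite !inE class_set_subset -andbA; congr (_ && _); rewrite -all_predI.
by apply: eq_all => x /=; rewrite !inE.
Qed.

Lemma sorted_tuples_class_subset t (v : t.-tuple 'I_q) :
  v \in sorted_tuples R t -> class_set v \subset C.
Proof.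
rewrite inE class_set_subset => /andP[_ /allP vR].
by apply/allP => y /vR; exact: cl_in.
Qed.

(** The tuples v with [class_set v \subset L] are the nondecreasing tuples on k #|L|
letters, so the inversion applies to [binomial_composition_sum]. *)
Lemma card_sorted_class_set t (L : {set K}) : L \subset C ->
  #|[set v in sorted_tuples R t | class_set v == L]| = composition_sum k #|L| t.
Proof.
move: L; apply: (@binomial_inversion _ C
  (fun L => #|[set v in sorted_tuples R t | class_set v == L]|)
  (fun l => composition_sum k l t)) => L LC.
rewrite binomial_composition_sum -card_class_union // -card_sorted_tuples_in.
rewrite -[RHS]sum1_card (partition_big (@class_set t) (fun L' => L' \subset L)) /=.
  apply: eq_bigr => L' sL'; rewrite -sum1_card; apply: eq_bigl => v.
  rewrite sorted_tuples_class in_set -andbA; congr (_ && _).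
  by case: eqP => [->|_]; rewrite ?sL' ?andbF.
by move=> v; rewrite sorted_tuples_class => /andP[].
Qed.

(** Fixing L = class_set v leaves for u the letters of R outside the classes in
nu @: L; injectivity of nu makes their number depend on #|L| only. *)
Lemma card_avoiding_pairs s t :
  #|avoiding_pairs s t| =
    \sum_(l < #|C|.+1)
      'C(#|C|, l) * (multichoose (k * (#|C| - l)) s * composition_sum k l t).
Proof.
rewrite -(sum_subsets_card C
   (fun l => multichoose (k * (#|C| - l)) s * composition_sum k l t)).
rewrite -sum1_card.
rewrite (partition_big (fun uv => class_set uv.2) (fun L => L \subset C)) /=.
  apply: eq_bigr => L LC.
  rewrite -card_sorted_class_set //.
  have -> : multichoose (k * (#|C| - #|L|)) s =
            #|sorted_tuples (R :\: [set x | cl x \in nu @: L]) s|.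
    rewrite card_sorted_tuples_in; congr multichoose.
    have sC : nu @: L \subset C.
      by apply/subsetP => _ /imsetP[c cL ->]; rewrite nu_stable // (subsetP LC).
    rewrite -(card_imset L nu_inj) -(cardsDS sC) -card_class_union ?subsetDl //.
    apply: eq_card => x; rewrite !inE andbC.
    by case xR: (x \in R); rewrite ?andbF //= cl_in ?andbT.
  rewrite -cardsX -sum1_card; apply: eq_bigl => -[u v].
  rewrite in_setX !in_set /=.
  case: eqP => [<-|_]; last by rewrite !andbF.
  rewrite !andbT andbCA andbC -!andbA; congr (_ && _).
  rewrite andbC andbAC; congr (_ && _); rewrite /allrel -all_predI.
  apply: eq_all => x; rewrite /= !inE; congr (_ && _).
  apply/allP/negP => [u_v /imsetP[_ /imsetP[y yv ->]] | u_v y yv].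
    by apply/eqP; exact: u_v.
  by apply/eqP => cl_xy; apply: u_v; rewrite cl_xy; do 2 apply: imset_f.
by move=> [u v]; rewrite inE /= => /and3P[_ /sorted_tuples_class_subset].
Qed.

End AvoidingPairs.

(** * Residue classes *)

Section Residues.

Variables (p q : nat).
Hypothesis p_gt0 : 0 < p.

Definition residue (x : 'I_q) : 'I_p := Ordinal (ltn_pmod x p_gt0).

(** The case c = 0 needs the reduction modulo p, since p - 0 is not a residue. *)
Definition residue_opp (c : 'I_p) : 'I_p := Ordinal (ltn_pmod (p - c) p_gt0).

Lemma residue_oppP (x y : 'I_q) :
  (residue x == residue_opp (residue y)) = (p %| x + y).
Proof.
rewrite -val_eqE /= -(eqn_modDr (y %% p)) subnK; last exact: ltnW (ltn_pmod _ _).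
by rewrite modnn modnDmr.
Qed.

Lemma residue_opp_inj : injective residue_opp.
Proof.
have nuE c : val (residue_opp c) + c = 0 %[mod p].
  by rewrite /= modnDml subnK ?modnn ?mod0n // ltnW.
move=> c d eq_cd; apply: val_inj.
have /eqP := nuE c; rewrite eq_cd -[X in _ == X](nuE d) eqn_modDl.
by rewrite !modn_small // => /eqP.
Qed.

Hypothesis p_dvd_q : p %| q.

Lemma card_residue_class (c : 'I_p) : #|[set x : 'I_q | residue x == c]| = q %/ p.
Proof.
have f_lt (i : 'I_(q %/ p)) : i * p + c < q.
  rewrite -[q in _ < q](divnK p_dvd_q) (leq_trans (n := i.+1 * p)) ?leq_mul2r //.
    by rewrite mulSn addnC ltn_add2r.
  by rewrite ltn_ord orbT.
pose f i := Ordinal (f_lt i).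
have f_inj : injective f.
  move=> i j /(congr1 val) /= /addIn /eqP.
  by rewrite eqn_pmul2r // => /eqP /val_inj.
rewrite -[RHS]card_ord -(card_imset _ f_inj); apply: eq_card => x.
rewrite inE -val_eqE /=; apply/eqP/imsetP => [xc|[i _ ->] /=]; last first.
  by rewrite modnMDl modn_small.
have x_lt : x %/ p < q %/ p by rewrite ltn_divLR // divnK.
by exists (Ordinal x_lt); rewrite ?inE //; apply: val_inj; rewrite /= -xc -divn_eq.
Qed.

Lemma card_multiples : #|[set x : 'I_q | p %| x]| = q %/ p.
Proof.
by rewrite -(card_residue_class (Ordinal p_gt0)).
Qed.

Definition residue_avoiding_pairs (R : {set 'I_q}) s t :=
  avoiding_pairs residue residue_opp R s t.

Lemma card_residue_avoiding_pairsT s t :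
  #|residue_avoiding_pairs setT s t| =
    \sum_(l < p.+1)
      'C(p, l) * (multichoose (q %/ p * (p - l)) s * composition_sum (q %/ p) l t).
Proof.
have := @card_avoiding_pairs q _ residue residue_opp setT setT (q %/ p)
  residue_opp_inj _ _ _ s t.
rewrite cardsT card_ord; apply=> [c _|c _|c _]; rewrite ?in_setT //.
by rewrite -[RHS](card_residue_class c); apply: eq_card => x; rewrite !inE.
Qed.

Hypothesis p_le_q : p <= q.

Definition small_entries : {set 'I_q} := [set x : 'I_q | 0 < x < p].

Lemma card_residue_avoiding_pairs_small s t :
  #|residue_avoiding_pairs small_entries s t| =
    \sum_(l < (p - 1).+1)
      'C(p - 1, l) * (multichoose (p - 1 - l) s * composition_sum 1 l t).
Proof.
have cardC : #|[set c : 'I_p | 0 < c]| = p - 1.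
  have := cardsC1 (Ordinal p_gt0); rewrite card_ord -subn1 => <-.
  apply: eq_card => c.
  by rewrite !inE -val_eqE /= lt0n.
have := @card_avoiding_pairs q _ residue residue_opp small_entries
  [set c : 'I_p | 0 < c] 1 residue_opp_inj _ _ _ s t.
rewrite cardC; under eq_bigr do rewrite mul1n.
apply=> [c|x|c]; rewrite !inE.
- by move=> c_gt0; rewrite /= modn_small ?subn_gt0 // ltn_subrL c_gt0.
- by case/andP => x_gt0 x_lt; rewrite /= modn_small.
move=> c_gt0; apply/eqP/cards1P; exists (widen_ord p_le_q c); apply/setP=> x.
rewrite !inE -!val_eqE /=; apply/andP/eqP => [[/andP[_ x_lt]]|->].
  by rewrite modn_small // => /eqP.
by rewrite c_gt0 ltn_ord modn_small // eqxx.
Qed.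

End Residues.

(** * Defect and canonical shapes *)

Section Canonical.

Variables (p q : nat).

Lemma defect_eq0 m n (a : m.-tuple 'I_q) (b : n.-tuple 'I_q) :
  0 < m -> 0 < n ->
  (defect p a b == 0) = allrel (fun x y : 'I_q => ~~ (p %| x + y)) a b.
Proof.
move=> m_gt0 n_gt0; rewrite -leqn0; apply/bigmax_leqP/allrelP; last first.
  move=> ab [d d_lt] /existsP[i /existsP[j /and3P[_ _ /forallP ij]]] /=.
  rewrite leqn0; case: d d_lt i j ij => // d d_lt i j /(_ ord0).
  by rewrite (negbTE (ab _ _ (mem_tnth _ _) (mem_tnth _ _))).
move=> no_matching _ _ /tnthP[i ->] /tnthP[j ->]; apply/negP => ij.
have d_lt : 1 < (minn m n).+1 by rewrite ltnS leq_min m_gt0.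
suff /(no_matching (Ordinal d_lt)) : has_matching p a b (Ordinal d_lt) by [].
have inj (k : nat) (x : 'I_k) : injectiveb [ffun _ : 'I_1 => x].
  by apply/injectiveP => s t _; rewrite (ord1 s) (ord1 t).
apply/existsP; exists [ffun=> i]; apply/existsP; exists [ffun=> j].
by rewrite !inj; apply/forallP => t; rewrite !ffunE.
Qed.

(** The first e entries of a and the first f entries of b are all divisible by p,
while the later ones are positive and smaller than p; hence a sum can be
divisible by p only if both entries or neither come from these initial
segments, and the last clause of the shape excludes the latter. *)
Lemma shape_dvdn m n (a : m.-tuple 'I_q) (b : n.-tuple 'I_q) e f i j :
  canonical_shape p a b e f ->
  (p %| tnth a i + tnth b j) = (i < e) && (j < f).
Proof.
case/and5P=> /forallP/(_ i) + /forallP/(_ i) + _ /forallP/(_ j) + /and4P[]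
  /forallP/(_ j) + /forallP/(_ j) + _ /forallP/(_ i)/forallP/(_ j).
have not_dvd x : 0 < x < p -> p %| x = false.
  by case/andP=> x_gt0 x_lt; rewrite gtnNdvd.
case: (ltnP i e) => [_ /= /eqP -> _ | _ _ /= a_i]; last first.
  move=> b_lt b_f b_gt; case: (ltnP j f) => [lt_jf _ | _ /negbTE //].
  suff p_bj : p %| tnth b j by rewrite dvdn_addl // not_dvd.
  move: lt_jf; rewrite leq_eqVlt => /orP[/(implyP b_f) //|/(implyP b_lt)/eqP ->].
  exact: dvdn0.
rewrite add0n => b_lt b_f; case: (ltnP j f) => [+ _ _ | _ /not_dvd //].
by rewrite leq_eqVlt => /orP[/(implyP b_f) //|/(implyP b_lt)/eqP ->]; rewrite dvdn0.
Qed.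

(** By [shape_dvdn] a matching lives inside the rectangle e x f, so its size is at
most each side, and the diagonal attains the smaller one. *)
Lemma defect_shape m n (a : m.-tuple 'I_q) (b : n.-tuple 'I_q) e f :
  e <= m -> f <= n -> canonical_shape p a b e f -> defect p a b = minn e f.
Proof.
move=> le_em le_fn shape; apply/eqP; rewrite eqn_leq; apply/andP; split.
  apply/bigmax_leqP => d /existsP[i /existsP[j /and3P[/injectiveP i_inj]]].
  move=> /injectiveP j_inj /forallP ij; rewrite leq_min.
  have {}ij t : (i t < e) && (j t < f) by rewrite -(shape_dvdn _ _ shape).
  have lt_ie t : i t < e by case/andP: (ij t).
  have lt_jf t : j t < f by case/andP: (ij t).
  have i'_inj : injective (fun t => Ordinal (lt_ie t)).
    by move=> s t /(congr1 val) /= /val_inj /i_inj.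
  have j'_inj : injective (fun t => Ordinal (lt_jf t)).
    by move=> s t /(congr1 val) /= /val_inj /j_inj.
  by move: (leq_card _ i'_inj) (leq_card _ j'_inj); rewrite !card_ord => -> ->.
have lt_d : minn e f < (minn m n).+1.
  by rewrite ltnS leq_min !geq_min le_em le_fn orbT.
suff d_match : has_matching p a b (Ordinal lt_d).
  exact: (@leq_bigmax_cond _ _ (@nat_of_ord _) (Ordinal lt_d) d_match).
have le_dm : minn e f <= m by rewrite geq_min le_em.
have le_dn : minn e f <= n by rewrite geq_min le_fn orbT.
apply/existsP; exists [ffun t => widen_ord le_dm t].
apply/existsP; exists [ffun t => widen_ord le_dn t].
apply/and3P; split.
- by apply/injectiveP => s t; rewrite !ffunE => /(congr1 val) /= /val_inj.
- by apply/injectiveP => s t; rewrite !ffunE => /(congr1 val) /= /val_inj.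
apply/forallP => t; rewrite !ffunE (shape_dvdn _ _ shape) /=.
by rewrite -leq_min.
Qed.

Lemma leq_of_initial_subset N c d :
  c <= N -> (forall i, i < N -> i < c -> i < d) -> c <= d.
Proof.
by case: c => // c lt_cN; apply.
Qed.

(** By [shape_dvdn] the pairs of positions with sum divisible by p form the
rectangle e x f; a nonempty rectangle determines its sides. *)
Lemma shape_unique m n (a : m.-tuple 'I_q) (b : n.-tuple 'I_q) e f e' f' :
    0 < e <= m -> 0 < f <= n -> 0 < e' <= m -> 0 < f' <= n ->
    canonical_shape p a b e f -> canonical_shape p a b e' f' ->
  (e, f) = (e', f').
Proof.
move=> /andP[e0 em] /andP[f0 fn] /andP[e'0 e'm] /andP[f'0 f'n] shape shape'.
have same i j : (i < m) -> (j < n) -> (i < e) && (j < f) = (i < e') && (j < f').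
  move=> im jn; rewrite -(shape_dvdn (Ordinal im) (Ordinal jn) shape).
  exact: shape_dvdn (Ordinal im) (Ordinal jn) shape'.
have m_gt0 : 0 < m by exact: leq_trans em.
have n_gt0 : 0 < n by exact: leq_trans fn.
congr pair.
  have eq_e i : i < m -> (i < e) = (i < e').
    by move=> im; have := same i 0 im n_gt0; rewrite f0 f'0 !andbT.
  by apply/eqP; rewrite eqn_leq; apply/andP; split;
    apply: (leq_of_initial_subset (N := m)) => // i /eq_e ->.
have eq_f j : j < n -> (j < f) = (j < f').
  by move=> jn; have := same 0 j m_gt0 jn; rewrite e0 e'0.
by apply/eqP; rewrite eqn_leq; apply/andP; split;
    apply: (leq_of_initial_subset (N := n)) => // j /eq_f ->.
Qed.

Hypothesis p_gt0 : 0 < p.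

Lemma defect0_canonical m n : 0 < m -> 0 < n ->
  [set ab : m.-tuple 'I_q * n.-tuple 'I_q |
     (defect p ab.1 ab.2 == 0) && canonical p ab.1 ab.2]
  = residue_avoiding_pairs p_gt0 setT m n.
Proof.
move=> m_gt0 n_gt0; apply/setP => -[a b]; rewrite !inE /= /canonical.
have allT k (u : k.-tuple 'I_q) : all (mem [set: 'I_q]) u.
  by apply/allP => x _; rewrite inE.
rewrite !allT !andbT defect_eq0 //.
set nd := allrel _ a b; set nd' := allrel _ a b.
have -> : nd' = nd by apply: eq_allrel => x y; rewrite residue_oppP.
by case: nd; rewrite ?andbF ?andbT.
Qed.

Definition with_shape m n e f : {set m.-tuple 'I_q * n.-tuple 'I_q} :=
  [set ab | canonical_shape p ab.1 ab.2 e f].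

(** Outside defect 0 the pair (e, f) is a function of the tuple, so the canonical
tuples are fibred over the pairs (e, f) with e, f > 0. *)
Lemma can_split m n : 0 < m -> 0 < n ->
  can p q m n = #|residue_avoiding_pairs (q := q) p_gt0 setT m n| +
    \sum_(1 <= e < m.+1) \sum_(1 <= f < n.+1) #|with_shape m n e f|.
Proof.
move=> m_gt0 n_gt0.
rewrite /can -(cardsID [set ab | defect p ab.1 ab.2 == 0]); congr (_ + _).
  rewrite -defect0_canonical //; apply: eq_card => ab.
  by rewrite !inE andbC.
have sum_ord k (F : nat -> nat) :
    \sum_(1 <= i < k.+1) F i = \sum_(i < k.+1 | 0 < i) F i.
  by rewrite [RHS]big_mkcond big_ord_recl big_add1 big_mkord.
rewrite sum_ord; under eq_bigr do rewrite sum_ord.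
rewrite pair_big /=.
pose good (ab : m.-tuple 'I_q * n.-tuple 'I_q) (ef : 'I_m.+1 * 'I_n.+1) :=
  [&& 0 < ef.1, 0 < ef.2 & canonical_shape p ab.1 ab.2 ef.1 ef.2].
(* h recovers (e, f); its default value is never met on the tuples counted. *)
pose h ab := odflt (ord0, ord0) [pick ef | good ab ef].
have hP ab ef : good ab ef -> h ab = ef.
  move=> g; rewrite /h; case: pickP => [ef' g' | /(_ ef)]; last by rewrite g.
  case/and3P: g => e0 f0 shape; case/and3P: g' => e'0 f'0 shape'.
  case: ef' ef e0 f0 shape e'0 f'0 shape' => [e' f'] [e f] /= e0 f0 shape e'0 f'0.
  move=> shape'.
  have pos k (i : 'I_k.+1) : 0 < i -> 0 < i <= k by move->; rewrite -ltnS ltn_ord.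
  have [] := shape_unique (pos _ _ e'0) (pos _ _ f'0) (pos _ _ e0) (pos _ _ f0)
    shape' shape.
  by move=> /val_inj -> /val_inj ->.
have mem_good ab : ab \in [set ab | canonical p ab.1 ab.2] :\:
    [set ab | defect p ab.1 ab.2 == 0] -> good ab (h ab).
  rewrite !inE /canonical; case: eqP => //= d0.
  case/existsP => e /existsP[f /andP[/eqP def shape]].
  suff g : good ab (e, f) by rewrite (hP _ _ g).
  rewrite /good /= shape andbT -leq_min -def lt0n; exact/eqP.
rewrite -sum1_card.
rewrite (partition_big h (fun ef => (0 < ef.1) && (0 < ef.2))) /=; last first.
  by move=> ab /mem_good /and3P[-> ->].
apply: eq_bigr => -[e f] /andP[/= e0 f0]; rewrite -sum1_card.
apply: eq_bigl => ab; apply/andP/idP => [[ab_can /eqP hab]|].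
  by have := mem_good ab ab_can; rewrite hab /with_shape inE => /and3P[].
rewrite inE => shape.
have g : good ab (e, f) by rewrite /good /= e0 f0.
rewrite (hP _ _ g) eqxx; split=> //.
have def := defect_shape (ltn_ord e : e <= m) (ltn_ord f : f <= n) shape.
rewrite !inE /canonical def.
have -> : (minn e f == 0) = false by apply/negbTE; rewrite -lt0n leq_min e0.
by apply/existsP; exists e; apply/existsP; exists f; rewrite eqxx.
Qed.

End Canonical.

(** * Tuples of a given shape *)

Section Shape.

Variables (p q : nat).
Hypothesis p_gt0 : 0 < p.
Hypothesis q_gt0 : 0 < q.
Hypothesis p_dvd_q : p %| q.

Let z : 'I_q := Ordinal q_gt0.
Let zeros e s (u : s.-tuple 'I_q) := [tuple of nseq e z ++ u].

Let zeros_cons f t x (v : t.-tuple 'I_q) := zeros f [tuple of x :: v].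

Lemma tnth_zeros_l e s (u : s.-tuple 'I_q) i : tnth (zeros e u) (lshift s i) = z.
Proof. by rewrite (tnth_nth z) nth_cat size_nseq /= ltn_ord nth_nseq ltn_ord. Qed.

Lemma tnth_zeros_r e s (u : s.-tuple 'I_q) i :
  tnth (zeros e u) (rshift e i) = tnth u i.
Proof.
by rewrite !(tnth_nth z) nth_cat size_nseq /= ltnNge leq_addr addKn.
Qed.

Lemma tnth_zeros_cons_head f t x (v : t.-tuple 'I_q) :
  tnth (zeros_cons f x v) (rshift f ord0) = x.
Proof. by rewrite tnth_zeros_r. Qed.

Lemma tnth_zeros_cons_tail f t x (v : t.-tuple 'I_q) j :
  tnth (zeros_cons f x v) (rshift f (lift ord0 j)) = tnth v j.
Proof. by rewrite tnth_zeros_r tnthS. Qed.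

Lemma forall_cat e s (P : pred 'I_(e + s)) :
  [forall i, P i] = [forall i, P (lshift s i)] && [forall i, P (rshift e i)].
Proof.
apply/forallP/andP => [Pi | [/forallP Pl /forallP Pr] i].
  by split; apply/forallP => i; apply: Pi.
by case: (split_ordP i) => j ->.
Qed.

Lemma forall_cons t (P : pred 'I_t.+1) :
  [forall i, P i] = P ord0 && [forall i, P (lift ord0 i)].
Proof.
apply/forallP/andP => [Pi | [P0 /forallP Pl] i]; first by split=> //; apply/forallP.
by case: (unliftP ord0 i) => [j ->|->].
Qed.

Lemma forall_tnth s (P : pred 'I_q) (u : s.-tuple 'I_q) :
  [forall i, P (tnth u i)] = all P u.
Proof.
apply/forallP/allP => [Pu _ /tnthP[i ->] // | Pu i]; exact: Pu (mem_tnth _ _).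
Qed.

(** Evaluated on a concatenation, each clause of the shape either holds trivially
or becomes a condition on x, on u, on v or on the pair (u, v). *)
Lemma shape_zeros e s f t x (u : s.-tuple 'I_q) (v : t.-tuple 'I_q) :
  canonical_shape p (zeros e u) (zeros f [tuple of x :: v]) e f.+1 =
    (p %| x) && ((u, v) \in residue_avoiding_pairs p_gt0 (small_entries p q) s t).
Proof.
rewrite /canonical_shape !inE /=.
have -> : drop e (nseq e z ++ u) = u by rewrite drop_size_cat // size_nseq.
have -> : drop f.+1 (nseq f z ++ x :: v) = v.
  by rewrite -cat_rcons drop_size_cat // size_rcons size_nseq.
rewrite -/(zeros_cons f x v) !forall_cat !forall_cons !tnth_zeros_cons_head /=.
have lt_add (i : nat) : (f < f + bump 0 i) by rewrite /bump addnS ltnS leq_addr.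
have -> : [forall i : 'I_e, (i < e) ==> (tnth (zeros e u) (lshift s i) == 0 :> nat)].
  by apply/forallP => i; rewrite tnth_zeros_l implybT.
have -> : [forall i : 'I_s, (e + i < e) ==>
    (tnth (zeros e u) (rshift e i) == 0 :> nat)].
  by apply/forallP => i; rewrite ltnNge leq_addr.
have -> : [forall i : 'I_e, (e <= i) ==> (0 < tnth (zeros e u) (lshift s i) < p)].
  by apply/forallP => i; rewrite leqNgt ltn_ord.
have -> : [forall i : 'I_s, (e <= e + i) ==> (0 < tnth (zeros e u) (rshift e i) < p)]
    = all (mem (small_entries p q)) u.
  rewrite -forall_tnth; apply: eq_forallb => i.
  by rewrite leq_addr tnth_zeros_r /= inE.
have -> : [forall j : 'I_f, (j.+1 < f.+1) ==>
    (tnth (zeros_cons f x v) (lshift t.+1 j) == 0 :> nat)].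
  by apply/forallP => i; rewrite tnth_zeros_l implybT.
have -> : [forall j : 'I_t, ((f + bump 0 j).+1 < f.+1) ==>
    (tnth (zeros_cons f x v) (rshift f (lift ord0 j)) == 0 :> nat)].
  by apply/forallP => j; rewrite ltnS ltnNge ltnW.
have -> : [forall j : 'I_f, (j.+1 == f.+1) ==>
    (p %| tnth (zeros_cons f x v) (lshift t.+1 j))].
  by apply/forallP => j; rewrite eqSS ltn_eqF.
have -> : [forall j : 'I_t, ((f + bump 0 j).+1 == f.+1) ==>
    (p %| tnth (zeros_cons f x v) (rshift f (lift ord0 j)))].
  by apply/forallP => j; rewrite eqSS gtn_eqF.
have -> : [forall j : 'I_f, (f < j) ==>
    (0 < tnth (zeros_cons f x v) (lshift t.+1 j) < p)].
  by apply/forallP => j; rewrite ltnNge ltnW.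
have -> : [forall j : 'I_t, (f < f + bump 0 j) ==>
    (0 < tnth (zeros_cons f x v) (rshift f (lift ord0 j)) < p)]
    = all (mem (small_entries p q)) v.
  rewrite -forall_tnth; apply: eq_forallb => j.
  by rewrite lt_add tnth_zeros_cons_tail /= inE.
have -> : [forall i : 'I_e, forall j : 'I_(f + t.+1), (e <= i) && (f < j) ==>
    ~~ (p %| tnth (zeros e u) (lshift s i) + tnth (zeros_cons f x v) j)].
  by apply/forallP => i; apply/forallP => j; rewrite leqNgt ltn_ord.
have -> : [forall i : 'I_s, forall j : 'I_(f + t.+1), (e <= e + i) && (f < j) ==>
    ~~ (p %| tnth (zeros e u) (rshift e i) + tnth (zeros_cons f x v) j)]
    = allrel (fun x y => residue p_gt0 x != residue_opp p_gt0 (residue p_gt0 y)) u v.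
  rewrite /allrel -forall_tnth; apply: eq_forallb => i /=.
  rewrite -forall_tnth forall_cat forall_cons /= leq_addr addn0 ltnn.
  have -> : [forall j : 'I_f, (f < j) ==> ~~ (p %| tnth (zeros e u) (rshift e i)
      + tnth (zeros_cons f x v) (lshift t.+1 j))].
    by apply/forallP => j; rewrite ltnNge ltnW.
  apply: eq_forallb => j.
  by rewrite lt_add tnth_zeros_r tnth_zeros_cons_tail residue_oppP.
rewrite addn0 eqxx !ltnn /=.
by do !case: nondecreasing; do !case: all; rewrite ?andbT ?andbF.
Qed.

Lemma shape_is_zeros e s f t (a : (e + s).-tuple 'I_q) (b : (f + t.+1).-tuple 'I_q) :
  canonical_shape p a b e f.+1 ->
  exists u : s.-tuple 'I_q, exists x, exists v : t.-tuple 'I_q,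
    a = zeros e u /\ b = zeros f [tuple of x :: v].
Proof.
case/and5P => /forallP a0 _ _ /forallP b0 _.
exists [tuple tnth a (rshift e i) | i < s].
exists (tnth b (rshift f ord0)), [tuple tnth b (rshift f (lift ord0 j)) | j < t].
split; apply: eq_from_tnth => i; case: (split_ordP i) => j ->.
- rewrite tnth_zeros_l; apply: val_inj; apply/eqP.
  by apply: (implyP (a0 (lshift s j))); rewrite /= ltn_ord.
- by rewrite tnth_zeros_r tnth_mktuple.
- rewrite tnth_zeros_l; apply: val_inj; apply/eqP.
  by apply: (implyP (b0 (lshift _ j))); rewrite /= ltnS ltn_ord.
case: (unliftP ord0 j) => [k ->|->]; last by rewrite tnth_zeros_cons_head.
by rewrite tnth_zeros_cons_tail tnth_mktuple.
Qed.

Lemma card_with_shape e s f t :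
  #|with_shape p q (e + s) (f + t.+1) e f.+1| =
    q %/ p * #|residue_avoiding_pairs p_gt0 (small_entries p q) s t|.
Proof.
rewrite -(card_multiples p_gt0 p_dvd_q) -cardsX.
pose g (w : 'I_q * (s.-tuple 'I_q * t.-tuple 'I_q)) :=
  (zeros e w.2.1, zeros f [tuple of w.1 :: w.2.2]).
have g_inj : injective g.
  move=> [x [u v]] [x' [u' v']] [/eqP + /eqP].
  rewrite !eqseq_cat // !eqxx /= eqseq_cons => /eqP/val_inj -> /andP[/eqP ->].
  by move/eqP/val_inj ->.
rewrite -(card_imset _ g_inj); apply: eq_card => -[a b].
rewrite inE /=; apply/idP/imsetP => [shape | [[x [u v]] + [-> ->]]].
  have [u [x [v [Da Db]]]] := shape_is_zeros shape.
  exists (x, (u, v)); last by rewrite /g Da Db.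
  by move: shape; rewrite Da Db shape_zeros in_setX inE.
by rewrite shape_zeros in_setX inE.
Qed.

End Shape.

(** * The formulas *)

(** Restricts the sum over all class counts to the range of the stated formulas;
the discarded terms vanish. *)
Lemma sum_ord_truncate N c (F : nat -> nat) :
    c <= N -> F 0 = 0 -> (forall l, c < l <= N -> F l = 0) ->
  \sum_(l < N.+1) F l = \sum_(1 <= l < c.+1) F l.
Proof.
move=> le_cN F0 Fbig; rewrite -(big_mkord xpredT F) big_ltn // F0 add0n.
rewrite (@big_cat_nat _ _ _ c.+1) //= [X in _ + X]big_nat_cond.
rewrite [X in _ + X]big1 ?addn0 // => l.
by rewrite andbT ltnS => /Fbig.
Qed.

Section Counting.

Variables (p q : nat).
Hypothesis p_prime : prime p.
Hypothesis p_dvd_q : p %| q.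
Hypothesis q_gt0 : 0 < q.

Let p_gt0 := prime_gt0 p_prime.
Let k := q %/ p.

Let q_k : q = k * p. Proof. by rewrite divnK. Qed.
Let p_le_q : p <= q. Proof. exact: dvdn_leq. Qed.

Let D m n := #|residue_avoiding_pairs (q := q) p_gt0 setT m n|.
Let T s t := #|residue_avoiding_pairs p_gt0 (small_entries p q) s t|.

(** Reindexed by the lengths of the tails, which are m - e and n - f in terms of
the parameters of the shape. *)
Lemma canE m n : 0 < m -> 0 < n ->
  can p q m n = D m n + k * \sum_(e < m) \sum_(f < n) T e f.
Proof.
move=> m_gt0 n_gt0; rewrite (@can_split p q p_gt0) //; congr (_ + _).
rewrite big_nat_rev big_add1 big_mkord big_distrr; apply: eq_bigr => e _.
rewrite big_nat_rev big_add1 big_mkord big_distrr; apply: eq_bigr => f _ /=.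
rewrite !add1n !subSS.
have := card_with_shape p_gt0 q_gt0 p_dvd_q (m - e) e (n - f.+1) f.
by rewrite subnSK // !subnK // ltnW.
Qed.

Lemma small_pairs0n t : T 0 t = multichoose (p - 1) t.
Proof.
rewrite /T card_residue_avoiding_pairs_small // -[p - 1 in RHS]mul1n.
rewrite -binomial_composition_sum.
by apply: eq_bigr => l _; rewrite multichoosen0 mul1n.
Qed.

Lemma small_pairsn0 s : T s 0 = multichoose (p - 1) s.
Proof.
rewrite /T card_residue_avoiding_pairs_small // big_ord_recl big1 => [|l _].
  by rewrite bin0 composition_sum0n muln1 mul1n subn0 addn0.
by rewrite composition_sum_small // !muln0.
Qed.

(** The classes are singletons, so composition sums become binomials; l = p - 1
contributes nothing since u would have no letter left. *)
Lemma small_pairs_gt0 s t : 0 < s -> 0 < t ->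
  T s t = \sum_(1 <= l < (minn t (p - 2)).+1)
    'C(p - 1, l) * 'C(t - 1, t - l) * 'C(s + p - l - 2, s).
Proof.
move=> s_gt0 t_gt0; have p_gt1 := prime_gt1 p_prime.
rewrite /T card_residue_avoiding_pairs_small //.
rewrite (@sum_ord_truncate _ (minn t (p - 2)) (fun l => 'C(p - 1, l) *
    (multichoose (p - 1 - l) s * composition_sum 1 l t))) //.
- apply: eq_big_nat => l /andP[l_gt0]; rewrite ltnS leq_min => /andP[le_lt le_lp].
  rewrite composition_sum1l // -mulnA; congr (_ * _); rewrite mulnC; congr (_ * _).
    by rewrite -[LHS]bin_sub ?leq_sub2r //; congr 'C(_, _); lia.
  by rewrite /multichoose; congr 'C(_, _); lia.
- by rewrite geq_min; apply/orP; right; lia.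
- by rewrite composition_sum0n eqn0Ngt t_gt0 !muln0.
move=> l; rewrite gtn_min => /andP[/orP[lt_tl | lt_pl] le_l].
  by rewrite composition_sum_small // !muln0.
have -> : p - 1 - l = 0 by lia.
by rewrite multichoose0n eqn0Ngt s_gt0 muln0.
Qed.

Lemma sum_small_pairs0n n : 0 < n -> \sum_(f < n) T 0 f = 'C(p + n - 2, n - 1).
Proof.
case: n => // n _; under eq_bigr do rewrite small_pairs0n.
rewrite multichoose_hockey_stick subn1 prednK // /multichoose.
by congr 'C(_, _); lia.
Qed.

Lemma sum_small_pairsn0 m : 0 < m -> \sum_(e < m) T e 0 = 'C(p + m - 2, m - 1).
Proof.
move=> m_gt0; rewrite -sum_small_pairs0n //.
by apply: eq_bigr => e _; rewrite small_pairsn0 small_pairs0n.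
Qed.

Lemma card_defect0_n1 m : D m 1 = q * 'C(q - k + m - 1, m).
Proof.
rewrite /D card_residue_avoiding_pairsT // -/k.
rewrite (@sum_ord_truncate _ 1 (fun l => 'C(p, l) *
    (multichoose (k * (p - l)) m * composition_sum k l 1))) //.
- rewrite big_nat1 bin1 composition_sumn1 multichoosen1 mulnBr muln1 -q_k.
  by rewrite mulnCA [p * k]mulnC -q_k mulnC.
- by rewrite composition_sum0n !muln0.
by move=> l /andP[lt_1l _]; rewrite composition_sum_small // !muln0.
Qed.

(** A single entry of a may take k (p - l) values, and (p - l) 'C(p, l) =
p 'C(p - 1, l) turns the sum into a subset sum for p - 1 classes. *)
Lemma card_defect0_1n n : D 1 n = q * 'C(q - k + n - 1, n).
Proof.
rewrite /D card_residue_avoiding_pairsT // -/k.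
have -> : 'C(q - k + n - 1, n) = multichoose (k * (p - 1)) n.
  by rewrite mulnBr muln1 -q_k.
rewrite -binomial_composition_sum subn1 prednK // big_ord_recr /=.
rewrite subnn muln0 multichoose0n muln0 addn0 big_distrr; apply: eq_bigr => l _.
rewrite multichoosen1 /= [in RHS]q_k -!mulnA mulnCA; congr (_ * _).
by rewrite mulnCA !mulnA mul_bin_down.
Qed.

Lemma card_defect0_gt0 m n : 0 < m -> 0 < n ->
  D m n = \sum_(1 <= l < (minn (p - 1) n).+1)
    'C(p, l) * 'C(q - k * l + m - 1, m) * composition_sum k l n.
Proof.
move=> m_gt0 n_gt0; rewrite /D card_residue_avoiding_pairsT // -/k.
rewrite (@sum_ord_truncate _ (minn (p - 1) n) (fun l => 'C(p, l) *
    (multichoose (k * (p - l)) m * composition_sum k l n))) //.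
- by apply: eq_bigr => l _; rewrite mulnA mulnBr -q_k.
- by rewrite geq_min leq_subr.
- by rewrite composition_sum0n eqn0Ngt n_gt0 !muln0.
move=> l; rewrite gtn_min => /andP[/orP[lt_pl | lt_nl] le_l].
  have -> : p - l = 0 by lia.
  by rewrite muln0 multichoose0n eqn0Ngt m_gt0 muln0.
by rewrite composition_sum_small // !muln0.
Qed.

(** The terms with e = 0 and those with f = 0 share the pair of empty tails,
whence the subtraction of 1. *)
Lemma sum_small_pairs m n : 0 < m -> 0 < n ->
  \sum_(e < m) \sum_(f < n) T e f =
    'C(p + m - 2, m - 1) + 'C(p + n - 2, n - 1) - 1 +
    \sum_(1 <= e < m) \sum_(1 <= f < n) T e f.
Proof.
move=> m_gt0 n_gt0; rewrite -sum_small_pairsn0 // -sum_small_pairs0n //.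
have split0 N (F : nat -> nat) : 0 < N ->
    \sum_(i < N) F i = F 0 + \sum_(1 <= i < N) F i.
  by move=> N0; rewrite -(big_mkord xpredT) big_ltn.
rewrite (split0 m (fun e => \sum_(f < n) T e f)) //.
rewrite (split0 m (T^~ 0)) // small_pairs0n multichoosen0.
have -> : \sum_(1 <= e < m) \sum_(f < n) T e f =
    \sum_(1 <= e < m) T e 0 + \sum_(1 <= e < m) \sum_(1 <= f < n) T e f.
  by rewrite -big_split; apply: eq_bigr => e _; rewrite /= (split0 n (T e)).
rewrite addnA; congr (_ + _).
by rewrite -addnA addKn addnC.
Qed.

End Counting.

Theorem proposition6p6 (p r q : nat) (p_prime : prime p) (r_ge1 : 1 <= r)
    (q_def : q = p ^ r) :
  [/\ forall m : nat, 1 <= m ->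
        can p q m 1 =
          q * 'C(q - q %/ p + m - 1, m) + q %/ p * 'C(p + m - 2, m - 1),
      forall n : nat, 1 <= n ->
        can p q 1 n =
          q * 'C(q - q %/ p + n - 1, n) + q %/ p * 'C(p + n - 2, n - 1)
    & forall m n : nat, 1 < m -> 1 < n ->
        can p q m n =
          \sum_(1 <= l < (minn (p - 1) n).+1)
             'C(p, l) * 'C(q - q %/ p * l + m - 1, m)
               * composition_sum (q %/ p) l n
          + q %/ p * ('C(p + m - 2, m - 1) + 'C(p + n - 2, n - 1) - 1)
          + q %/ p *
             (\sum_(1 <= e < m) \sum_(1 <= f < n)
                \sum_(1 <= l < (minn f (p - 2)).+1)
                   'C(p - 1, l) * 'C(f - 1, f - l) * 'C(e + p - l - 2, e))].
Proof.
have p_dvd_q : p %| q by rewrite q_def dvdn_exp.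
have q_gt0 : 0 < q by rewrite q_def expn_gt0 prime_gt0.
split=> [m m_gt0 | n n_gt0 | m n m_gt1 n_gt1].
- rewrite (canE p_prime) // card_defect0_n1 //.
  rewrite -(sum_small_pairsn0 p_prime p_dvd_q q_gt0 m_gt0).
  by congr (_ + _ * _); apply: eq_bigr => e _; rewrite big_ord1.
- rewrite (canE p_prime) // card_defect0_1n //.
  rewrite -(sum_small_pairs0n p_prime p_dvd_q q_gt0 n_gt0).
  by congr (_ + _ * _); rewrite big_ord1.
have m_gt0 := ltnW m_gt1; have n_gt0 := ltnW n_gt1.
rewrite (canE p_prime) // card_defect0_gt0 // sum_small_pairs // mulnDr addnA.
congr (_ + _ * _); apply: eq_big_nat => e /andP[e_gt0 _].
by apply: eq_big_nat => f /andP[f_gt0 _]; rewrite small_pairs_gt0.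
Qed.
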